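(* Let $p\neq q$ be primes and let $\mathbf P=\mathbf C_{p^{r_1}}\times\dots\times\mathbf C_{p^{r_k}}$, $\mathbf Q=\mathbf C_{q^{t_1}}\times\dots\times\mathbf C_{q^{t_l}}$ with $r_1\geq\dots\geq r_k\geq 1$, $t_1\geq\dots\geq t_l\geq 1$, $k,l\geq1$, and assume that neither $\mathbf P$ nor $\mathbf Q$ has prime exponent (i.e. $r_1\geq 2$ and $t_1\geq 2$). Put $n=r_1+\dots+r_k$ and $m=t_1+\dots+t_l$. Similarly let $p'\neq q'$ be primes and $\mathbf P'=\mathbf C_{p'^{r'_1}}\times\dots\times\mathbf C_{p'^{r'_{k'}}}$, $\mathbf Q'=\mathbf C_{q'^{t'_1}}\times\dots\times\mathbf C_{q'^{t'_{l'}}}$ with $r'_1\geq\dots\geq r'_{k'}\geq1$, $t'_1\geq\dots\geq t'_{l'}\geq1$, $r'_1\geq 2$, $t'_1\geq 2$, $n'=\sum r'_i$, $m'=\sum t'_j$. If $\mathcal D(\mathbf P\times\mathbf Q)\cong\mathcal D(\mathbf P'\times\mathbf Q')$, then $(p',n',k',r'_1,q',m',l',t'_1)$ equals either $(p,n,k,r_1,q,m,l,t_1)$ or $(q,m,l,t_1,p,n,k,r_1)$. That is, the difference graph $\mathcal D(\mathbf P\times\mathbf Q)$ uniquely determines the parameters $p,q,n,m,k,l,r_1,t_1$ (up to interchanging the roles of the two Sylow subgroups).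
   Context: $\mathbf C_N$ denotes the cyclic group of order $N$. The power graph of a group $\mathbf K$ is the simple graph on $K$ in which two distinct elements are adjacent iff one is a power of the other; the enhanced power graph of $\mathbf K$ is the simple graph on $K$ in which two distinct elements are adjacent iff they generate a cyclic subgroup. The difference graph $\mathcal D(\mathbf K)$ is the graph whose edges are the pairs adjacent in the enhanced power graph but not in the power graph, with all isolated vertices removed. *)

(* Defs.v *)
From HB Require Import structures.
From mathcomp Require Import all_boot all_order all_fingroup all_algebra.
From mathcomp Require Import all_solvable.

Set Implicit Arguments.
Unset Strict Implicit.
Unset Printing Implicit Defensive.

Import GroupScope.

Record sgraph := SGraph {
  vertex :> finType;
  adj : rel vertex;
  adj_sym : symmetric adj;
  adj_irrefl : irreflexive adj
}.

Definition graph_iso (A B : sgraph) : Prop :=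
  exists2 f : A -> B,
    bijective f & forall x y : A, adj (f x) (f y) = adj x y.

Section GraphsOfGroup.

Variable gT : finGroupType.

Definition power_adj : rel gT :=
  fun x y => (x != y) && ((x \in <[y]>) || (y \in <[x]>)).

Lemma power_adj_sym : symmetric power_adj.
Proof. by move=> x y; rewrite /power_adj eq_sym orbC. Qed.

Lemma power_adj_irrefl : irreflexive power_adj.
Proof. by move=> x; rewrite /power_adj eqxx. Qed.

Definition power_graph : sgraph := SGraph power_adj_sym power_adj_irrefl.

Definition enhanced_power_adj : rel gT :=
  fun x y => (x != y) && cyclic <<[set x; y]>>.

Lemma enhanced_power_adj_sym : symmetric enhanced_power_adj.
Proof. by move=> x y; rewrite /enhanced_power_adj eq_sym setUC. Qed.

Lemma enhanced_power_adj_irrefl : irreflexive enhanced_power_adj.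
Proof. by move=> x; rewrite /enhanced_power_adj eqxx. Qed.

Definition enhanced_power_graph : sgraph :=
  SGraph enhanced_power_adj_sym enhanced_power_adj_irrefl.

Definition difference_adj : rel gT :=
  fun x y => @adj enhanced_power_graph x y && ~~ @adj power_graph x y.

Lemma difference_adj_sym : symmetric difference_adj.
Proof. by move=> x y; rewrite /difference_adj adj_sym [X in ~~ X]adj_sym. Qed.

Lemma difference_adj_irrefl : irreflexive difference_adj.
Proof. by move=> x; rewrite /difference_adj adj_irrefl. Qed.

Definition full_difference_graph : sgraph :=
  SGraph difference_adj_sym difference_adj_irrefl.

End GraphsOfGroup.

Section RemoveIsolated.

Variable A : sgraph.

Definition non_isolated : pred A := fun x => [exists y : A, adj x y].

Definition induced_adj : rel {x : A | non_isolated x} :=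
  fun x y => adj (val x) (val y).

Lemma induced_adj_sym : symmetric induced_adj.
Proof. by move=> x y; rewrite /induced_adj adj_sym. Qed.

Lemma induced_adj_irrefl : irreflexive induced_adj.
Proof. by move=> x; rewrite /induced_adj adj_irrefl. Qed.

Definition remove_isolated : sgraph := SGraph induced_adj_sym induced_adj_irrefl.

End RemoveIsolated.

Definition difference_graph (gT : finGroupType) : sgraph :=
  remove_isolated (full_difference_graph gT).

(* For s = [:: s_1; ...; s_k], the external direct product of the cyclic groups
   of order p ^ s_i. The group law of 'Z_N is addition mod N; 'Z_N has order N
   as soon as 1 < N, which holds when p is prime and every s_i is positive. *)
Definition prod_cyclic (p : nat) (s : seq nat) : finGroupType :=
  {dffun forall i : 'I_(size s), 'Z_(p ^ nth 0 s i)%N}.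

(* s lists exponents s_1 >= ... >= s_k >= 1 with k >= 1 and s_1 >= 2. *)
Definition exponents (s : seq nat) : Prop :=
  [/\ 0 < size s, sorted geq s, all (leq 1) s & 2 <= head 0 s].

(* Main.v *)
(** In [P * Q], comparing cyclic subgroups coordinatewise, [(a, b)] and [(c, d)]
    are adjacent in the difference graph iff [<[a]> < <[c]>] and [<[d]> < <[b]>],
    or the other way around. Call an edge [x y] dominating if every non-isolated
    vertex has a neighbour adjacent to [x] or to [y]. The edges joining [(1, b)]
    to [(a, 1)] with [a], [b] of prime order are dominating, and they turn out to
    be exactly the dominating edges minimising [deg x * deg y]: for a dominating
    edge with [a < c], [d < b], every non-maximal cyclic subgroup of [P] is
    comparable with [<[a]>], so that if [a != 1] the elements not above [a] lie
    in a proper subgroup, which makes [deg x * deg y] too large; likewise for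
    [d]. On such an edge, [deg (1, b) = |P| - 1], the vertices with the same
    neighbourhood as [(a, 1)] number [p ^ k - 1], and the largest degree of a
    neighbour of [(1, b)] is [p ^ (r_1 - 1) * (|Q| - 1)]; together with the
    symmetric data these determine all the parameters. *)

Require Import Defs.
From HB Require Import structures.
From mathcomp Require Import all_boot all_order all_fingroup all_algebra.
From mathcomp Require Import all_solvable.

Set Implicit Arguments.
Unset Strict Implicit.
Unset Printing Implicit Defensive.

Import GroupScope.

(** * Graph invariants that single out an edge *)

Section GraphInvariants.

Variable A : sgraph.
Implicit Types x y z : A.

Definition nbh x : {set A} := [set y | adj x y].

Definition deg x := #|nbh x|.

Definition twins x := #|[set z | nbh z == nbh x]|.

Definition nbh_deg x := \max_(z in nbh x) deg z.

(** Only non-isolated vertices are tested, so that the notion survives the removal of isolated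
    vertices. *)
Definition dominating x y :=
  adj x y && [forall z : A, non_isolated z ==>
    [exists w : A, adj z w && (adj x w || adj y w)]].

Definition minimal_dominating x y :=
  dominating x y /\
  forall u v : A, dominating u v -> (deg x * deg y <= deg u * deg v)%N.

Lemma dominating_sym x y : dominating x y = dominating y x.
Proof.
rewrite /dominating adj_sym; congr (_ && _); apply: eq_forallb => z.
by congr (_ ==> _); apply: eq_existsb => w; rewrite orbC.
Qed.

Lemma minimal_dominating_sym x y :
  minimal_dominating x y -> minimal_dominating y x.
Proof. by case=> xy min_xy; split; rewrite 1?dominating_sym 1?mulnC. Qed.

End GraphInvariants.

(** * Invariance under embeddings that reach every non-isolated vertex *)

Section CoreEmbedding.

(* This covers both isomorphisms and the inclusion of the graph obtained by
   removing isolated vertices. *)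
Variables (A B : sgraph) (f : A -> B).
Hypothesis f_inj : injective f.
Hypothesis f_adj : forall x y, adj (f x) (f y) = adj x y.
Hypothesis f_onto : forall y : B, non_isolated y -> exists x, y = f x.

(** A neighbour of [f x] is non-isolated, hence in the image of [f]; the other invariance lemmas
    build on this. *)
Lemma nbh_embedding x : nbh (f x) = f @: nbh x.
Proof.
apply/setP=> y; rewrite inE; apply/idP/imsetP=> [xy | [z]]; last first.
  by rewrite inE => xz ->; rewrite f_adj.
have [|z yE] := f_onto (y := y).
  by apply/existsP; exists (f x); rewrite adj_sym.
by exists z; rewrite // inE -f_adj -yE.
Qed.

Lemma deg_embedding x : deg (f x) = deg x.
Proof. by rewrite /deg nbh_embedding card_imset. Qed.

Lemma non_isolated_embedding x : non_isolated (f x) = non_isolated x.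
Proof.
apply/existsP/existsP=> [[y xy] | [y xy]]; last by exists (f y); rewrite f_adj.
have: y \in nbh (f x) by rewrite inE.
by rewrite nbh_embedding => /imsetP[z]; rewrite inE; exists z.
Qed.

(** For an isolated [x] this can fail: isolated vertices of [B] outside the image would count as
    twins of [f x]. *)
Lemma twins_embedding x : non_isolated x -> twins (f x) = twins x.
Proof.
case/existsP=> w xw; rewrite /twins -(card_imset _ f_inj).
congr #|pred_of_set _|.
apply/setP=> y; rewrite inE; apply/eqP/imsetP=> [yE | [z]]; last first.
  by rewrite inE => /eqP zE ->; rewrite !nbh_embedding zE.
have [|z zE] := f_onto (y := y).
  apply/existsP; exists (f w); move/setP/(_ (f w)): yE.
  by rewrite !inE f_adj xw.
exists z => //; rewrite inE; apply/eqP; apply: (imset_inj f_inj).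
by rewrite -!nbh_embedding -zE.
Qed.

Lemma nbh_deg_embedding x : nbh_deg (f x) = nbh_deg x.
Proof.
rewrite /nbh_deg nbh_embedding big_imset /=; last first.
  by move=> ? ? _ _; apply: f_inj.
by apply: eq_bigr => z _; rewrite deg_embedding.
Qed.

Lemma dominating_embedding x y : dominating (f x) (f y) = dominating x y.
Proof.
rewrite /dominating f_adj; congr (_ && _); apply/forallP/forallP=> dom z.
  apply/implyP=> z_ni; move/implyP/(_ _)/existsP: (dom (f z)).
  rewrite non_isolated_embedding => /(_ z_ni)[w /andP[zw xyw]].
  have: w \in nbh (f z) by rewrite inE.
  rewrite nbh_embedding => /imsetP[u _ wE]; apply/existsP; exists u.
  by move: zw xyw; rewrite wE !f_adj => -> ->.
apply/implyP=> z_ni; have [u zE] := f_onto z_ni.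
move/implyP/(_ _)/existsP: (dom u); rewrite -non_isolated_embedding -zE.
case/(_ z_ni)=> w uw; apply/existsP; exists (f w).
by rewrite zE !f_adj.
Qed.

Lemma minimal_dominating_embedding x y :
  minimal_dominating (f x) (f y) <-> minimal_dominating x y.
Proof.
rewrite /minimal_dominating dominating_embedding !deg_embedding.
split=> -[xy min_xy]; split=> // u v uv.
  by rewrite -(deg_embedding u) -(deg_embedding v) min_xy ?dominating_embedding.
have [/existsP-nu /existsP-nv]: non_isolated u /\ non_isolated v.
  case/andP: uv => uv _.
  by split; apply/existsP; [exists v | exists u; rewrite adj_sym].
have [u' uE] := f_onto (introT existsP nu).
have [v' vE] := f_onto (introT existsP nv).
rewrite uE vE !deg_embedding min_xy // -dominating_embedding.
by rewrite -uE -vE.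
Qed.

End CoreEmbedding.

Definition profile (A : sgraph) (x y : A) :=
  ((deg x, twins x, nbh_deg x), (deg y, twins y, nbh_deg y)).

Lemma profile_embedding (A B : sgraph) (f : A -> B) (x y : A) :
    injective f -> (forall u v, adj (f u) (f v) = adj u v) ->
    (forall z : B, non_isolated z -> exists u, z = f u) -> adj x y ->
  profile (f x) (f y) = profile x y.
Proof.
move=> f_inj f_adj f_onto xy; rewrite /profile !(deg_embedding f_inj) //.
rewrite !(nbh_deg_embedding f_inj) // !(twins_embedding f_inj) //.
  by apply/existsP; exists x; rewrite adj_sym.
by apply/existsP; exists y.
Qed.

(** Presents [val] as a map between vertices of graphs, as the embedding lemmas expect. *)
Definition core_val (A : sgraph) : remove_isolated A -> A := val.

Lemma core_val_inj (A : sgraph) : injective (@core_val A).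
Proof. exact: val_inj. Qed.

Lemma core_val_adj (A : sgraph) (u v : remove_isolated A) :
  adj (core_val u) (core_val v) = adj u v.
Proof. by []. Qed.

Lemma core_val_onto (A : sgraph) (z : A) :
  non_isolated z -> exists u, z = core_val u.
Proof. by move=> z_ni; exists (Sub z z_ni); rewrite /core_val SubK. Qed.

(** The edge is pulled back to the core of [A], moved along the isomorphism and pushed into [B], so
    that all computations can be done with the isolated vertices still present. *)
Lemma minimal_dominating_transport (A B : sgraph) (x y : A) :
    graph_iso (remove_isolated A) (remove_isolated B) ->
    minimal_dominating x y ->
  exists u v : B, minimal_dominating u v /\ profile u v = profile x y.
Proof.
case=> f f_bij f_adj xy.
have f_onto z : non_isolated z -> exists u, z = f u.
  by case: f_bij => g _ gK _; exists (g z); rewrite gK.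
have f_inj := bij_inj f_bij.
have xy_adj : adj x y by case: xy => /andP[].
have [|u xE] := core_val_onto (z := x); first by apply/existsP; exists y.
have [|v yE] := core_val_onto (z := y).
  by apply/existsP; exists x; rewrite adj_sym.
have core_min (C : sgraph) := minimal_dominating_embedding
  (@core_val_inj C) (@core_val_adj C) (@core_val_onto C).
have core_profile (C : sgraph) a b := @profile_embedding _ _ _ a b
  (@core_val_inj C) (@core_val_adj C) (@core_val_onto C).
have uv : adj u v by rewrite -core_val_adj -xE -yE.
exists (core_val (f u)), (core_val (f v)); split.
  have uv_min : minimal_dominating u v.
    by apply: (core_min A u v).1; rewrite -xE -yE.
  apply: (core_min B (f u) (f v)).2.
  exact: (minimal_dominating_embedding f_inj f_adj f_onto u v).2 uv_min.
rewrite core_profile ?f_adj // (profile_embedding f_inj f_adj f_onto) //.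
by rewrite xE yE core_profile.
Qed.

(** * Strict inclusion between cyclic subgroups *)

Section CyclicOrder.

Variable gT : finGroupType.
Implicit Types a b c g u : gT.

Definition cycle_lt a c := <[a]> \proper <[c]>.

Definition cycle_comparable a c := (a \in <[c]>) || (c \in <[a]>).

Definition above a : {set gT} := [set c | cycle_lt a c].

Definition below a : {set gT} := [set c | cycle_lt c a].

Definition max_below := \max_(a : gT) #|below a|.

(** [below a] has one element exactly when [a] has prime order: 1 is then the only element of
    [<[a]>] that does not generate it. *)
Definition atoms := #|[set a : gT | #|below a| == 1%N]|.

Lemma cycle_ltE a c : cycle_lt a c = (a \in <[c]>) && (c \notin <[a]>).
Proof. by rewrite /cycle_lt properE !cycle_subG. Qed.

Lemma cycle_ltxx a : cycle_lt a a = false.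
Proof. exact: properxx. Qed.

Lemma cycle_lt_trans a b c : cycle_lt a b -> cycle_lt b c -> cycle_lt a c.
Proof. exact: proper_trans. Qed.

Lemma cycle_lt_mem a c : cycle_lt a c -> a \in <[c]>.
Proof. by rewrite cycle_ltE => /andP[]. Qed.

Lemma cycle_lt_asym a c : cycle_lt a c -> cycle_lt c a = false.
Proof. by rewrite !cycle_ltE => /andP[-> /negPf->]. Qed.

Lemma cycle_lt_comparable a c : cycle_lt a c -> cycle_comparable a c.
Proof. by rewrite /cycle_comparable => /cycle_lt_mem->. Qed.

Lemma cycle_lt1 c : cycle_lt 1 c = (c != 1).
Proof. by rewrite cycle_ltE group1 cycle1 inE. Qed.

Lemma cycle_ltx1 a : cycle_lt a 1 = false.
Proof. by rewrite cycle_ltE group1 andbF. Qed.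

Lemma cycle_lt_neq1 a c : cycle_lt a c -> c != 1.
Proof. by apply: contraTneq => ->; rewrite cycle_ltx1. Qed.

Lemma below1 : below 1 = set0.
Proof. by apply/setP=> c; rewrite !inE cycle_ltx1. Qed.

Lemma card_above1 : #|above 1| = #|gT|.-1.
Proof.
rewrite -cardsT (cardsD1 1 [set: gT]) inE add1n /=; apply: eq_card => c.
by rewrite !inE andbT cycle_lt1.
Qed.

Lemma atom_neq1 a : #|below a| = 1%N -> a != 1.
Proof. by apply: contra_eq_neq => ->; rewrite below1 cards0. Qed.

Lemma below_atom a : #|below a| = 1%N -> below a = [set 1].
Proof.
move=> a_atom; have /eqP/cards1P[c belowE] := a_atom.
have: 1 \in below a by rewrite inE cycle_lt1 atom_neq1.
by rewrite belowE inE => /eqP->.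
Qed.

Lemma leq_order_below d b : cycle_lt d b -> #[d] <= #|below b|.
Proof.
move=> db; apply: subset_leq_card; apply/subsetP=> c cd; rewrite inE.
by apply: sub_proper_trans db; rewrite cycle_subG.
Qed.

(** An element of largest order works; it is not 1, because 1 lies strictly below every other
    element. *)
Lemma exists_cycle_maximal :
  1 < #|gT| -> exists2 h : gT, h != 1 & forall u, cycle_lt h u = false.
Proof.
move=> nontriv.
case: (@arg_maxnP _ 1 predT (fun g : gT => #[g])) => // h _ h_max.
have h_top u : cycle_lt h u = false.
  by apply/negP => /proper_card; rewrite ltnNge; apply/negP/negPn/h_max.
exists h => //; apply: contraTneq nontriv => h1; rewrite -leqNgt -cardsT.
rewrite -(cards1 (1 : gT)); apply/subset_leq_card/subsetP=> u _.
by have:= h_top u; rewrite h1 cycle_lt1 inE => /negPn.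
Qed.

End CyclicOrder.

(** * Cyclic subgroups of a p-group *)

Section PGroupOrder.

Variables (gT : finGroupType) (p : nat).
Hypotheses (p_pr : prime p) (pG : p.-group [set: gT]).
Implicit Types a b c g u : gT.

Let p_elt a : p.-elt a.
Proof. exact: mem_p_elt pG (in_setT a). Qed.

(** Inside a cyclic group inclusion of subgroups is divisibility of orders, and powers of [p] form a
    chain. *)
Lemma cycle_comparable_in_cycle a b c :
  a \in <[c]> -> b \in <[c]> -> cycle_comparable a b.
Proof.
move=> ac bc; have [[i oa] [j ob]] := (p_natP (p_elt a), p_natP (p_elt b)).
have sub_dvd x y : x \in <[c]> -> y \in <[c]> -> (x \in <[y]>) = (#[x] %| #[y]).
  rewrite -!(cycle_subG x) -(cycle_subG y) => xc yc.
  by rewrite -(cardSg_cyclic (cycle_cyclic c) xc yc).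
rewrite /cycle_comparable (sub_dvd a b) // (sub_dvd b a) // oa ob.
by case/orP: (leq_total i j) => ij; rewrite !(dvdn_exp2l _ ij) ?orbT.
Qed.

Lemma dvdn_order_neq1 a : a != 1 -> p %| #[a].
Proof.
rewrite -order_gt1; have [[|i] ->] := p_natP (p_elt a); first by [].
by rewrite dvdn_exp.
Qed.

(** A power [b ^+ i] generates [<[b]>] when [p] does not divide [i], and lies in [<[b ^+ p]>]
    otherwise. *)
Lemma belowE b : b != 1 -> below b = <[b ^+ p]>.
Proof.
move=> b1; have pb := dvdn_order_neq1 b1.
have gen_bp : ~~ generator <[b]> (b ^+ p).
  by rewrite generator_coprime coprime_sym prime_coprime // pb.
apply/setP=> c; rewrite inE cycle_ltE; apply/andP/idP => [[/cycleP[i ->]] | cbp].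
  have [/dvdnP[k ->] _ | pNi] := boolP (p %| i).
    by rewrite mulnC expgM mem_cycle.
  case/negP; suff /eqP<- : generator <[b]> (b ^+ i) by apply: cycle_id.
  rewrite generator_coprime; have [j ->] := p_natP (p_elt b).
  by rewrite coprimeXl // prime_coprime.
have bp_b : <[b ^+ p]> \subset <[b]> by rewrite cycle_subG mem_cycle.
split; first exact: subsetP bp_b _ cbp.
apply: contra gen_bp => bc; rewrite /generator eqEsubset bp_b cycle_subG andbT.
by apply: subsetP bc; rewrite cycle_subG.
Qed.

Lemma card_below b : b != 1 -> #|below b| = #[b] %/ p.
Proof. by move=> b1; rewrite belowE // -orderE orderXdiv ?dvdn_order_neq1. Qed.

Lemma exists_atom : 1 < #|gT| -> exists a : gT, #|below a| = 1%N.
Proof.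
move=> nontriv; have [|a _ oa] := Cauchy p_pr (G := [set: gT]).
  have [[|k] cardG] := p_natP pG; last by rewrite cardG dvdn_exp.
  by move: nontriv; rewrite -cardsT cardG.
have a1 : a != 1 by rewrite -order_gt1 oa prime_gt1.
by exists a; rewrite card_below // oa divnn prime_gt0.
Qed.

Lemma cycle_lt_expp g : g != 1 -> cycle_lt (g ^+ p) g.
Proof.
move=> g1; have: g ^+ p \in below g by rewrite belowE ?cycle_id.
by rewrite inE.
Qed.

(* Elements not above [a] have their p-th power in [<[a ^+ p]>], and such
   elements form a proper subgroup. *)
Lemma leq_card_above a c :
    abelian [set: gT] -> a != 1 -> cycle_lt a c ->
    (forall g u, cycle_lt g u -> cycle_comparable g a) ->
  #|gT| <= #|above a| * #[a].
Proof.
move=> abG a1 ac a_comp.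
have groupH : group_set [set g : gT | g ^+ p \in <[a ^+ p]>].
  apply/group_setP; split=> [|g h]; rewrite !inE ?expg1n ?group1 // => Hg Hh.
  by rewrite expgMn ?groupM //; apply: (centsP abG); rewrite inE.
pose H := Group groupH.
have notH : ~: above a \subset H.
  apply/subsetP=> g; rewrite !inE /= => gNa.
  have [-> | g1] := eqVneq g 1; first by rewrite expg1n group1.
  have gp_lt := cycle_lt_expp g1.
  have aNg : a \notin <[g ^+ p]>.
    apply: contra gNa => a_gp; apply: sub_proper_trans gp_lt.
    by rewrite cycle_subG.
  have:= a_comp _ _ gp_lt; rewrite /cycle_comparable (negPf aNg) orbF => gp_a.
  by rewrite -belowE // inE cycle_ltE gp_a.
have cNH : c \notin H.
  rewrite inE -belowE // inE; apply/negP => cp_a.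
  have: a \in below c by rewrite inE.
  rewrite belowE ?(cycle_lt_neq1 ac) // => a_cp.
  by move: cp_a; rewrite cycle_ltE a_cp andbF.
have Hproper : H \proper [set: gT].
  by rewrite properE subsetT; apply/subsetPn; exists c.
have ind2 : 1 < #|[set: gT] : H| by rewrite indexg_gt1; case/andP: Hproper.
have cardH : #|H| * 2 <= #|gT|.
  by rewrite -cardsT -(Lagrange (subsetT H)) leq_mul2l ind2 orbT.
have order_a : 1 < #[a] by rewrite order_gt1.
(* The complement of [above a] fits in [H], so it is at most half of the group and [above a] is at
   least half; [#[a]] supplies the factor 2. *)
apply: leq_trans (leq_mul (leqnn _) order_a).
have := leq_trans (leq_mul (subset_leq_card notH) (leqnn 2)) cardH.
by rewrite -(cardsC (above a)) !muln2 -!addnn leq_add2r leq_add2l.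
Qed.

(** For [a = 1] both sides agree; for [a != 1] the previous bound is larger by one, hence strict.
    The equality case later forces [a = 1]. *)
Lemma leq_card_above_or1 a c :
    abelian [set: gT] -> cycle_lt a c ->
    (forall g u, cycle_lt g u -> cycle_comparable g a) ->
  #|gT|.-1 <= #|above a| * #[a] ?= iff (a == 1).
Proof.
move=> abG ac a_comp; have gT_gt0 : 0 < #|gT| by apply/card_gt0P; exists 1.
have [-> | a1] := eqVneq a 1.
  by rewrite order1 muln1 card_above1; apply/leqif_refl.
have := leq_card_above abG a1 ac a_comp; rewrite -(ltn_predK gT_gt0) => lt_a.
by split; [apply: ltnW | apply: ltn_eqF].
Qed.

(** The atoms are the elements of order [p]; the predecessor discards the identity. *)
Lemma atomsE : atoms gT = #|[set a : gT | a ^+ p == 1]|.-1.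
Proof.
rewrite [#|[set a : gT | _]|](cardsD1 1) inE expg1n eqxx add1n /=.
apply: eq_card => a; rewrite !inE -order_dvdn.
have [-> | a1] := eqVneq a 1; first by rewrite below1 cards0.
rewrite card_below // /=.
have [[|i] oa] := p_natP (p_elt a).
  by move: a1; rewrite -order_eq1 oa expn0.
have p_gt0 := prime_gt0 p_pr.
by rewrite oa expnS mulKn // -[X in _ %| X]muln1 dvdn_pmul2l // dvdn1.
Qed.

Lemma max_belowE :
  exponent [set: gT] != 1%N -> max_below gT = (exponent [set: gT] %/ p)%N.
Proof.
move=> exp1; have [w _ expE] := exponent_witness (pgroup_nil pG).
apply/eqP; rewrite eqn_leq expE; apply/andP; split.
  apply/bigmax_leqP=> a _; have [-> | a1] := eqVneq a 1.
    by rewrite below1 cards0.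
  rewrite card_below // leq_div2r // dvdn_leq // -expE.
  exact: dvdn_exponent.
rewrite -card_below; last by rewrite -order_eq1 -expE.
exact: (leq_bigmax (F := fun a : gT => #|below a|)).
Qed.

End PGroupOrder.

(** * The difference graph of a product of a p-group and a q-group *)

Lemma expg_pair (gT hT : finGroupType) (u : gT) (v : hT) n :
  (u, v) ^+ n = (u ^+ n, v ^+ n).
Proof. by elim: n => // n IHn; rewrite !expgS IHn. Qed.

Section ProductDifference.

Variables (pT qT : finGroupType) (p q : nat).
Hypotheses (p_pr : prime p) (q_pr : prime q) (p_neq_q : p != q).
Hypotheses (pP : p.-group [set: pT]) (qQ : q.-group [set: qT]).
Hypotheses (abP : abelian [set: pT]) (abQ : abelian [set: qT]).
Hypotheses (P_gt1 : 1 < #|pT|) (Q_gt1 : 1 < #|qT|).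

Implicit Types (a c g u : pT) (b d h v : qT).

Local Notation D := (full_difference_graph (pT * qT)%type).

(** The orders of [u] and [v] are coprime, so the Chinese remainder theorem merges the two exponents
    into one. *)
Lemma mem_cycle_pair a b u v :
  ((a, b) \in <[(u, v)]>) = (a \in <[u]>) && (b \in <[v]>).
Proof.
apply/idP/andP=> [/cycleP[n] | [/cycleP[i ->] /cycleP[j ->]]].
  by rewrite expg_pair => -[-> ->]; rewrite !mem_cycle.
have co_uv : coprime #[u] #[v].
  have [k ->] := p_natP (mem_p_elt pP (in_setT u)).
  have [l ->] := p_natP (mem_p_elt qQ (in_setT v)).
  by rewrite coprimeXl ?coprimeXr // prime_coprime // dvdn_prime2.
have -> : (u ^+ i, v ^+ j) = (u, v) ^+ (chinese #[u] #[v] i j).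
  rewrite expg_pair; congr (_, _); apply/eqP; rewrite eq_expg_mod_order.
    by rewrite chinese_modl.
  by rewrite chinese_modr.
exact: mem_cycle.
Qed.

(** Conversely to the chain property in each factor, the larger entry of each coordinate gives a
    generator of a cyclic group containing both pairs. *)
Lemma cyclic_pair a b c d :
  cyclic <<[set (a, b); (c, d)]>> = cycle_comparable a c && cycle_comparable b d.
Proof.
apply/idP/andP=> [/cyclicP[[u v] genE] | [/orP ac /orP bd]].
  have sub x : x \in [set (a, b); (c, d)] -> x \in <[(u, v)]>.
    by rewrite -genE; apply: mem_gen.
  have:= sub (a, b); have:= sub (c, d); rewrite !inE !eqxx orbT /=.
  rewrite !mem_cycle_pair => /(_ isT)/andP[cu dv] /(_ isT)/andP[au bv].
  split; [exact: (cycle_comparable_in_cycle pP au cu) |].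
  exact: (cycle_comparable_in_cycle qQ bv dv).
have sub_cyclic u v : (a, b) \in <[(u, v)]> -> (c, d) \in <[(u, v)]> ->
    cyclic <<[set (a, b); (c, d)]>>.
  move=> ab cd; apply: cyclicS (cycle_cyclic (u, v)).
  by rewrite gen_subG subUset !sub1set ab.
case: ac bd => ac [] bd; [apply: (sub_cyclic c d) | apply: (sub_cyclic c b)
  | apply: (sub_cyclic a d) | apply: (sub_cyclic a b)];
  by rewrite mem_cycle_pair ?ac ?bd ?cycle_id.
Qed.

(** Both coordinates are comparable, but neither pair is a power of the other: the two comparisons
    are strict and opposite. *)
Lemma adj_pair a b c d :
  @adj D (a, b) (c, d) =
    cycle_lt a c && cycle_lt d b || cycle_lt c a && cycle_lt b d.
Proof.
rewrite /= /difference_adj /= /enhanced_power_adj /power_adj cyclic_pair.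
rewrite !mem_cycle_pair !cycle_ltE /cycle_comparable.
have [[-> ->] | _] /= := (a, b) =P (c, d); first by rewrite !cycle_id.
by do 4![case: (_ \in _)].
Qed.

Lemma nbh_pair a b :
  @nbh D (a, b) = setX (above a) (below b) :|: setX (below a) (above b).
Proof. by apply/setP=> -[c d]; rewrite inE adj_pair !inE. Qed.

Lemma deg_pair a b :
  @deg D (a, b) = #|above a| * #|below b| + #|below a| * #|above b|.
Proof.
rewrite /deg nbh_pair cardsU !cardsX.
rewrite (_ : _ :&: _ = set0) ?cards0 ?subn0 //; apply/setP=> -[c d].
rewrite !inE; apply/negP=> /andP[/andP[ac _] /andP[ca _]].
by rewrite (cycle_lt_asym ac) in ca.
Qed.

Lemma nbh_1b b : @nbh D (1, b) = setX (above 1) (below b).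
Proof.
by rewrite nbh_pair below1; apply/setP=> -[c d]; rewrite !inE orbF.
Qed.

Lemma nbh_a1 a : @nbh D (a, 1) = setX (below a) (above 1).
Proof.
by rewrite nbh_pair below1; apply/setP=> -[c d]; rewrite !inE andbF.
Qed.

Lemma deg_1b b : @deg D (1, b) = (#|pT|.-1 * #|below b|)%N.
Proof. by rewrite /deg nbh_1b cardsX card_above1. Qed.

Lemma deg_a1 a : @deg D (a, 1) = (#|below a| * #|qT|.-1)%N.
Proof. by rewrite /deg nbh_a1 cardsX card_above1. Qed.

(** If [(g, h)] has a neighbour [(u, v)] with [g] below [u], then [(u, 1)] is adjacent to [(g, h)]
    and to [(1, b)]; in the opposite case [(1, v)] is adjacent to [(g, h)] and to [(a, 1)]. *)
Lemma dominating_axes a b : a != 1 -> b != 1 -> @dominating D (1, b) (a, 1).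
Proof.
move=> a1 b1; apply/andP; split; first by rewrite adj_pair !cycle_lt1 a1 b1.
apply/forallP=> -[g h]; apply/implyP=> /existsP[[u v]]; rewrite adj_pair.
case/orP=> /andP[lt1 lt2]; apply/existsP.
  exists (u, 1); rewrite !adj_pair !cycle_lt1 lt1 b1 (cycle_lt_neq1 lt1).
  by rewrite (cycle_lt_neq1 lt2).
exists (1, v); rewrite !adj_pair !cycle_lt1 lt2 a1 (cycle_lt_neq1 lt1).
by rewrite (cycle_lt_neq1 lt2) !orbT.
Qed.

(* Test the domination on [(g, h)] with [<[h]>] a maximal cyclic subgroup: its
   neighbours all lie above [g] in the first coordinate. *)
Lemma dominating_comparable_l a b c d g u :
    @dominating D (a, b) (c, d) -> cycle_lt a c -> cycle_lt d b ->
  cycle_lt g u -> cycle_comparable g a.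
Proof.
case/andP=> _ /forallP dom ac db gu.
have [h h1 h_max] := exists_cycle_maximal Q_gt1.
have /implyP/(_ _)/existsP[|[u' v]] := dom (g, h).
  by apply/existsP; exists (u, 1); rewrite adj_pair gu cycle_lt1 h1.
rewrite !adj_pair h_max andbF orbF => /andP[/andP[gu' _]].
have comp w : cycle_lt g w -> cycle_lt a w -> cycle_comparable g a.
  by move=> /cycle_lt_mem gw /cycle_lt_mem; apply: (cycle_comparable_in_cycle pP).
case/orP=> /orP[] /andP[lt1 _].
- exact: comp lt1.
- exact/cycle_lt_comparable/(cycle_lt_trans gu').
- exact/(comp u')/(cycle_lt_trans ac).
- by apply: (comp c) => //; apply: cycle_lt_trans lt1.
Qed.

(** Mirror image of [dominating_comparable_l]: now [<[g]>] is the maximal cyclic subgroup of the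
    test vertex. *)
Lemma dominating_comparable_r a b c d h v :
    @dominating D (a, b) (c, d) -> cycle_lt a c -> cycle_lt d b ->
  cycle_lt h v -> cycle_comparable h d.
Proof.
case/andP=> _ /forallP dom ac db hv.
have [g g1 g_max] := exists_cycle_maximal P_gt1.
have /implyP/(_ _)/existsP[|[u v']] := dom (g, h).
  by apply/existsP; exists (1, v); rewrite adj_pair hv cycle_lt1 g1 orbT.
rewrite !adj_pair g_max /= => /andP[/andP[_ hv']].
have comp w : cycle_lt h w -> cycle_lt d w -> cycle_comparable h d.
  by move=> /cycle_lt_mem hw /cycle_lt_mem; apply: (cycle_comparable_in_cycle qQ).
case/orP=> /orP[] /andP[_ lt2].
- by apply: (comp b) => //; apply: cycle_lt_trans lt2.
- exact/(comp v')/(cycle_lt_trans db).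
- exact/cycle_lt_comparable/(cycle_lt_trans hv').
- exact: comp lt2.
Qed.

Lemma leq_dominating a b c d :
    @dominating D (a, b) (c, d) -> cycle_lt a c -> cycle_lt d b ->
  #|pT|.-1 * #|qT|.-1 <= #|above a| * #[a] * (#|above d| * #[d])
    ?= iff (a == 1) && (d == 1).
Proof.
move=> dom ac db.
have leP := leq_card_above_or1 p_pr pP abP ac 
  (fun g u => dominating_comparable_l dom ac db).
have leQ := leq_card_above_or1 q_pr qQ abQ db 
  (fun h v => dominating_comparable_r dom ac db).
have P1_gt0 : 0 < #|pT|.-1 by rewrite -subn1 subn_gt0.
have Q1_gt0 : 0 < #|qT|.-1 by rewrite -subn1 subn_gt0.
(* [leqif_mul] also admits equality when the larger product vanishes; positivity excludes this. *)
have := leqif_mul leP leQ; rewrite eqn0Ngt.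
by rewrite muln_gt0 (leq_trans P1_gt0 leP) (leq_trans Q1_gt0 leQ).
Qed.

(** Each degree is bounded below by one of its two boxes, [above a] times [below b] and [below c]
    times [above d]; then [<[d]>] lies in [below b] and [<[a]>] in [below c]. *)
Lemma leq_deg_mul a b c d :
    cycle_lt a c -> cycle_lt d b ->
  #|above a| * #[a] * (#|above d| * #[d]) <= @deg D (a, b) * @deg D (c, d).
Proof.
move=> /leq_order_below le_ac /leq_order_below le_db; rewrite !deg_pair.
rewrite [(#|above d| * _)%N]mulnC mulnACA; apply: leq_mul.
  by apply: leq_trans (leq_addr _ _); rewrite leq_mul2l le_db orbT.
by apply: leq_trans (leq_addl _ _); rewrite leq_mul2r le_ac orbT.
Qed.

Lemma minimal_dominating_axes a b :
    #|below a| = 1%N -> #|below b| = 1%N -> @minimal_dominating D (1, b) (a, 1).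
Proof.
move=> a_atom b_atom; have [a1 b1] := (atom_neq1 a_atom, atom_neq1 b_atom).
split=> [|[u v] [u' v'] dom]; first exact: dominating_axes.
rewrite deg_1b deg_a1 a_atom b_atom muln1 mul1n.
(* Domination and the product of degrees do not depend on the orientation of the edge. *)
wlog /andP[uu' v'v] : u v u' v' dom / cycle_lt u u' && cycle_lt v' v.
  move=> IH; have /andP[] := dom; rewrite adj_pair.
  case/orP=> [lt_uv _ | /andP[u'u vv'] _]; first exact: IH.
  by rewrite [X in _ <= X]mulnC; apply: IH; rewrite 1?dominating_sym // u'u.
exact: leq_trans (leq_dominating dom uu' v'v) (leq_deg_mul uu' v'v).
Qed.

(** Comparison with an axis edge through atoms forces equality in [leq_dominating], so [a = d = 1].
    What remains of the degree bound is that the product of [#|below b|] and [#|below c|] is at most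
    1. *)
Lemma minimal_dominating_shape a b c d :
    @minimal_dominating D (a, b) (c, d) -> cycle_lt a c -> cycle_lt d b ->
  [/\ a = 1, d = 1, #|below b| = 1%N & #|below c| = 1%N].
Proof.
case=> dom dom_min ac db.
have [a0 a0_atom] := exists_atom p_pr pP P_gt1.
have [b0 b0_atom] := exists_atom q_pr qQ Q_gt1.
have := dom_min _ _ (dominating_axes (atom_neq1 a0_atom) (atom_neq1 b0_atom)).
rewrite deg_1b deg_a1 a0_atom b0_atom muln1 mul1n => le_min.
have [le_ad eq_ad] := leq_dominating dom ac db.
have /andP[/eqP a1 /eqP d1] : (a == 1) && (d == 1).
  by rewrite -eq_ad eqn_leq le_ad (leq_trans (leq_deg_mul ac db)).
have [b_gt0 c_gt0] := (leq_order_below db, leq_order_below ac).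
move: le_min b_gt0 c_gt0; rewrite a1 d1 deg_1b deg_a1 !order1.
rewrite [(#|below c| * _)%N]mulnC mulnACA -[X in _ <= X]muln1 leq_pmul2l.
  by case: #|below b| #|below c| => [|[|m]] [|[|n]].
by rewrite muln_gt0 -!subn1 !subn_gt0 P_gt1 Q_gt1.
Qed.

Lemma twins_1b b : #|below b| = 1%N -> @twins D (1, b) = atoms qT.
Proof.
move=> b_atom.
transitivity #|setX [set (1 : pT)] [set h : qT | #|below h| == 1%N]|; last first.
  by rewrite cardsX cards1 mul1n.
apply: eq_card => -[g h]; rewrite inE in_setX !inE.
apply/eqP/andP=> [nbhE | [/eqP-> /eqP h_atom]]; last first.
  by rewrite !nbh_1b (below_atom h_atom) (below_atom b_atom).
have nbh_gh u v : ((u, v) \in @nbh D (g, h)) = (u != 1) && (v == 1).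
  by rewrite nbhE nbh_1b below_atom // !inE cycle_lt1.
(* Otherwise [(g, 1)] would be a neighbour of [(g, h)], although adjacent vertices differ strictly
   in the first coordinate. *)
have g1 : g = 1.
  apply/eqP; have := nbh_gh g 1.
  by rewrite nbh_pair !inE !cycle_ltxx eqxx andbT => /esym/negPn.
rewrite g1 eqxx; split=> //; have [u /atom_neq1 u1] := exists_atom p_pr pP P_gt1.
apply/cards1P; exists 1; apply/setP=> v; have := nbh_gh u v.
by rewrite g1 nbh_1b !inE cycle_lt1 u1.
Qed.

Lemma twins_a1 a : #|below a| = 1%N -> @twins D (a, 1) = atoms pT.
Proof.
move=> a_atom.
transitivity #|setX [set g : pT | #|below g| == 1%N] [set (1 : qT)]|; last first.
  by rewrite cardsX cards1 muln1.
apply: eq_card => -[g h]; rewrite inE in_setX !inE.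
apply/eqP/andP=> [nbhE | [/eqP g_atom /eqP->]]; last first.
  by rewrite !nbh_a1 (below_atom g_atom) (below_atom a_atom).
have nbh_gh u v : ((u, v) \in @nbh D (g, h)) = (u == 1) && (v != 1).
  by rewrite nbhE nbh_a1 below_atom // !inE cycle_lt1.
have h1 : h = 1.
  apply/eqP; have := nbh_gh 1 h.
  by rewrite nbh_pair !inE !cycle_ltxx eqxx !andbF => /esym/negPn.
rewrite h1 eqxx; split=> //; have [v /atom_neq1 v1] := exists_atom q_pr qQ Q_gt1.
apply/cards1P; exists 1; apply/setP=> u; have := nbh_gh u v.
by rewrite h1 nbh_a1 !inE cycle_lt1 v1 !andbT.
Qed.

Lemma nbh_deg_1b b :
  #|below b| = 1%N -> @nbh_deg D (1, b) = (max_below pT * #|qT|.-1)%N.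
Proof.
move=> b_atom; apply/eqP; rewrite eqn_leq; apply/andP; split.
  apply/bigmax_leqP=> -[u v].
  rewrite nbh_1b below_atom // in_setX !inE => /andP[_ /eqP->].
  rewrite deg_a1 leq_mul2r; apply/orP; right.
  exact: (leq_bigmax (F := fun a : pT => #|below a|)).
have [|a max_a] := @eq_bigmax pT (fun a : pT => #|below a|); first exact: ltnW.
(* The vertex [(1, 1)] is not a neighbour of [(1, b)], but a maximum attained there is zero. *)
rewrite /max_below max_a -deg_a1; have [-> | a1] := eqVneq a 1.
  by rewrite deg_a1 below1 cards0.
apply: (leq_bigmax_cond (F := @deg D)).
by rewrite nbh_1b below_atom // !inE cycle_lt1 a1 eqxx.
Qed.

Lemma nbh_deg_a1 a :
  #|below a| = 1%N -> @nbh_deg D (a, 1) = (#|pT|.-1 * max_below qT)%N.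
Proof.
move=> a_atom; apply/eqP; rewrite eqn_leq; apply/andP; split.
  apply/bigmax_leqP=> -[u v].
  rewrite nbh_a1 below_atom // in_setX !inE => /andP[/eqP-> _].
  rewrite deg_1b leq_mul2l; apply/orP; right.
  exact: (leq_bigmax (F := fun b : qT => #|below b|)).
have [|b max_b] := @eq_bigmax qT (fun b : qT => #|below b|); first exact: ltnW.
rewrite /max_below max_b -deg_1b; have [-> | b1] := eqVneq b 1.
  by rewrite deg_1b below1 cards0 muln0.
apply: (leq_bigmax_cond (F := @deg D)).
by rewrite nbh_a1 below_atom // !inE cycle_lt1 b1 eqxx.
Qed.

(** The data at [(1, b)], for [b] an atom of [B]; exchanging [A] and [B] gives the data at
    [(a, 1)]. *)
Definition axis_profile (A B : finGroupType) :=
  (#|A|.-1, atoms B, (max_below A * #|B|.-1)%N).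

Lemma profile_axes a b :
    #|below a| = 1%N -> #|below b| = 1%N ->
  @profile D (1, b) (a, 1) = (axis_profile pT qT, axis_profile qT pT).
Proof.
move=> a_atom b_atom; rewrite /profile /axis_profile.
rewrite twins_1b // twins_a1 // nbh_deg_1b // nbh_deg_a1 // deg_1b deg_a1.
by rewrite a_atom b_atom muln1 mul1n [(#|pT|.-1 * max_below _)%N]mulnC.
Qed.

Lemma minimal_dominating_profile (x y : D) :
    minimal_dominating x y ->
  profile x y = (axis_profile pT qT, axis_profile qT pT) \/
  profile x y = (axis_profile qT pT, axis_profile pT qT).
Proof.
case: x y => a b [c d] xy; have := xy => -[/andP[]]; rewrite adj_pair.
case/orP=> /andP[lt1 lt2] _ _; [left | right].
  have [-> -> b_atom c_atom] := minimal_dominating_shape xy lt1 lt2.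
  exact: profile_axes.
have [-> -> d_atom a_atom] :=
  minimal_dominating_shape (minimal_dominating_sym xy) lt1 lt2.
exact: (congr1 (fun P => (P.2, P.1)) (profile_axes a_atom d_atom)).
Qed.

Lemma exists_minimal_dominating :
  exists x y : D, minimal_dominating x y /\
    profile x y = (axis_profile pT qT, axis_profile qT pT).
Proof.
have [a a_atom] := exists_atom p_pr pP P_gt1.
have [b b_atom] := exists_atom q_pr qQ Q_gt1.
exists (1, b), (a, 1); split; [exact: minimal_dominating_axes | exact: profile_axes].
Qed.

End ProductDifference.

(** * Order, torsion and exponent of a product of cyclic p-groups *)

Section ProdCyclic.

Variables (p : nat) (s : seq nat).
Hypotheses (p_pr : prime p) (s_exps : exponents s).

Local Notation P := (prod_cyclic p s).
Local Notation factor i := 'Z_(p ^ nth 0 s i).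

Let exp_gt0 (i : 'I_(size s)) : 0 < nth 0 s i.
Proof. by case: s_exps => _ _ /all_nthP-> . Qed.

Lemma Zp_cast_factor (i : 'I_(size s)) :
  (Zp_trunc (p ^ nth 0 s i)).+2 = (p ^ nth 0 s i)%N.
Proof. by rewrite Zp_cast // -(exp1n (nth 0 s i)) ltn_exp2r // prime_gt1. Qed.

Lemma expg_prod_cyclic (x : P) n i : (x ^+ n) i = (x i : factor i) ^+ n.
Proof.
elim: n => [|n IHn]; first by rewrite !expg0 oneg_ffun.
by rewrite !expgS mulg_ffun IHn.
Qed.

Lemma card_prod_cyclic : #|P| = (p ^ sumn s)%N.
Proof.
rewrite card_dep_ffun foldrE big_map big_enum /=.
under eq_bigr => i _ do rewrite card_ord Zp_cast_factor.
by rewrite -expn_sum sumnE (big_nth 0) big_mkord.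
Qed.

Lemma prod_cyclic_pgroup : p.-group [set: P].
Proof. by rewrite /pgroup cardsT card_prod_cyclic pnatX pnat_id. Qed.

Lemma prod_cyclic_abelian : abelian [set: P].
Proof.
apply/centsP=> x _ y _; apply/ffunP=> i; rewrite !mulg_ffun.
exact: Zp_mulgC.
Qed.

Lemma prod_cyclic_gt1 : 1 < #|P|.
Proof.
rewrite card_prod_cyclic -(exp1n (sumn s)) ltn_exp2r ?prime_gt1 //.
by case: s_exps => + _ _; case: s => // -[|k] s' _ //; rewrite addSn.
Qed.

(** The solutions form ['Ohm_1] of a nontrivial cyclic p-group, which has order [p]. *)
Lemma card_torsion_factor (i : 'I_(size s)) :
  #|[pred y : factor i | y ^+ p == 1]| = p.
Proof.
have cycG : cyclic [set: factor i] by apply/cyclicP; exists Zp1; apply: Zp_cycle.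
have pG : p.-group [set: factor i].
  by rewrite /pgroup cardsT card_ord Zp_cast_factor pnatX pnat_id.
have ntG : [set: factor i] != 1.
  by rewrite -cardG_gt1 cardsT card_ord.
have abO : abelian 'Ohm_1([set: factor i]).
  exact: abelianS (Ohm_sub _ _) (cyclic_abelian cycG).
rewrite -[RHS](Ohm1_cyclic_pgroup_prime cycG pG ntG) (OhmEabelian pG abO) expn1.
by apply: eq_card => y; rewrite !inE.
Qed.

Lemma atoms_prod_cyclic : atoms P = (p ^ size s).-1.
Proof.
rewrite (atomsE p_pr prod_cyclic_pgroup); congr _.-1.
pose torsion (i : 'I_(size s)) := [pred y : factor i | y ^+ p == 1].
transitivity #|(family torsion : simpl_pred P)|.
  apply: eq_card => x; rewrite inE; apply/eqP/familyP=> [xp i | xp].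
    by rewrite inE -expg_prod_cyclic xp oneg_ffun.
  apply/ffunP=> i; rewrite expg_prod_cyclic oneg_ffun.
  exact/eqP/xp.
rewrite card_family foldrE big_map big_enum /=.
under eq_bigr => i _ do rewrite card_torsion_factor.
by rewrite prod_nat_const card_ord.
Qed.

Lemma exponent_prod_cyclic : exponent [set: P] = (p ^ head 0 s)%N.
Proof.
have [s_gt0 s_sorted _ _] := s_exps.
apply/eqP; rewrite eqn_dvd; apply/andP; split.
  apply/exponentP=> x _; apply/ffunP=> i; rewrite expg_prod_cyclic oneg_ffun.
  apply/eqP; rewrite -order_dvdn.
  have := order_dvdG (in_setT (x i)); rewrite cardsT card_ord Zp_cast_factor.
  move=> dvd_o; apply: dvdn_trans dvd_o _; apply: dvdn_exp2l; rewrite -nth0.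
  have geq_trans : transitive geq by move=> a b c ab bc; apply: leq_trans bc ab.
  by apply: (sorted_leq_nth geq_trans leqnn 0 s_sorted 0 i); rewrite ?inE.
(* The generator of the first factor, extended by 1 elsewhere, attains the bound. *)
have := expg_exponent (in_setT (dfung1 (Zp1 : factor (Ordinal s_gt0)) : P)).
move/ffunP/(_ (Ordinal s_gt0)); rewrite expg_prod_cyclic dfung1_id oneg_ffun.
by move/eqP; rewrite -order_dvdn order_Zp1 Zp_cast_factor /= nth0.
Qed.

Lemma max_below_prod_cyclic : max_below P = (p ^ (head 0 s).-1)%N.
Proof.
have [_ _ _ head_ge2] := s_exps; have p_gt1 := prime_gt1 p_pr.
rewrite (max_belowE p_pr prod_cyclic_pgroup) exponent_prod_cyclic.
  by case: (head 0 s) head_ge2 => // k _; rewrite expnS mulKn ?prime_gt0.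
by case: (head 0 s) head_ge2 => // k _; rewrite gtn_eqF // -(exp1n k.+1) ltn_exp2r.
Qed.

End ProdCyclic.

(** * Recovering the parameters from the two profiles *)

Lemma prime_power_inj (p p' n n' : nat) :
    prime p -> prime p' -> 0 < n -> 0 < n' -> (p ^ n = p' ^ n')%N ->
  p = p' /\ n = n'.
Proof.
move=> p_pr p'_pr n_gt0 n'_gt0 E.
have pp' : p = p'.
  apply/eqP; rewrite -dvdn_prime2 //; have: p %| p' ^ n' by rewrite -E dvdn_exp.
  by rewrite Euclid_dvdX // => /andP[].
split=> //; move: E; rewrite -pp' => /eqP.
by rewrite eqn_exp2l ?prime_gt1 // => /eqP.
Qed.

Lemma sumn_exponents_gt0 (s : seq nat) : exponents s -> 0 < sumn s.
Proof. by case: s => [|k s] [] // _ _ _ /=; case: k. Qed.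

(** The order of the first group yields its prime and [sumn r], its atoms (found in the second
    profile) yield [size r], and the last entry of the first profile yields [head 0 r] after
    cancelling the order of the second group minus 1. *)
Lemma axis_profile_params (p q p' q' : nat) (r t r' t' : seq nat) :
    prime p -> prime q -> prime p' -> prime q' ->
    exponents r -> exponents t -> exponents r' -> exponents t' ->
    axis_profile (prod_cyclic p r) (prod_cyclic q t) =
      axis_profile (prod_cyclic p' r') (prod_cyclic q' t') ->
    axis_profile (prod_cyclic q t) (prod_cyclic p r) =
      axis_profile (prod_cyclic q' t') (prod_cyclic p' r') ->
  [/\ p' = p, sumn r' = sumn r, size r' = size r & head 0 r' = head 0 r].
Proof.
move=> p_pr q_pr p'_pr q'_pr r_exps t_exps r'_exps t'_exps.
rewrite /axis_profile !atoms_prod_cyclic // !max_below_prod_cyclic //.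
move=> [cardP _ headE] [cardQ atomsP _].
have predX_inj (x y m n : nat) : prime x -> prime y ->
    (x ^ m).-1 = (y ^ n).-1 -> (x ^ m)%N = (y ^ n)%N.
  move=> x_pr y_pr E.
  by rewrite -(prednK (n := x ^ m)) ?E ?prednK // expn_gt0 prime_gt0.
have Q1_gt0 : 0 < #|prod_cyclic q t|.-1.
  by rewrite -subn1 subn_gt0 prod_cyclic_gt1.
move: cardP; rewrite !card_prod_cyclic // => /(predX_inj _ _ _ _ p_pr p'_pr).
case/(prime_power_inj p_pr p'_pr (sumn_exponents_gt0 r_exps)
  (sumn_exponents_gt0 r'_exps)).
move=> pE sumE; split=> //.
  apply/esym; have [[r_gt0 _ _ _] [r'_gt0 _ _ _]] := (r_exps, r'_exps).
  by case/predX_inj/prime_power_inj: atomsP.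
apply/esym; move/eqP: headE; rewrite -cardQ eqn_pmul2r // -pE.
rewrite eqn_exp2l ?prime_gt1 // => /eqP.
(* Only the predecessors of the heads are known to agree; both heads are positive, so they agree
   too. *)
case: r_exps r'_exps => _ _ _ + [_ _ _].
by case: (head 0 r) (head 0 r') => [|k] [|k'] //= _ _ ->.
Qed.

(* n = sumn r, k = size r, r_1 = head 0 r, and likewise for the other lists. *)
Theorem theorem3p9 (p q p' q' : nat) (r t r' t' : seq nat)
  (p_prime : prime p) (q_prime : prime q) (p_neq_q : p <> q)
  (r_exps : exponents r) (t_exps : exponents t)
  (p'_prime : prime p') (q'_prime : prime q') (p'_neq_q' : p' <> q')
  (r'_exps : exponents r') (t'_exps : exponents t')
  (D_iso : graph_iso
     (difference_graph (prod_cyclic p r * prod_cyclic q t)%type)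
     (difference_graph (prod_cyclic p' r' * prod_cyclic q' t')%type)) :
  (p', sumn r', size r', head 0 r', q', sumn t', size t', head 0 t') =
    (p, sumn r, size r, head 0 r, q, sumn t, size t, head 0 t) \/
  (p', sumn r', size r', head 0 r', q', sumn t', size t', head 0 t') =
    (q, sumn t, size t, head 0 t, p, sumn r, size r, head 0 r).
Proof.
have [x [y [xy_min xyE]]] := exists_minimal_dominating p_prime q_prime
  (introN eqP p_neq_q) (prod_cyclic_pgroup p_prime r_exps)
  (prod_cyclic_pgroup q_prime t_exps) (prod_cyclic_abelian _ _)
  (prod_cyclic_abelian _ _) (prod_cyclic_gt1 p_prime r_exps)
  (prod_cyclic_gt1 q_prime t_exps).
have [u [v [uv_min uvE]]] := minimal_dominating_transport D_iso xy_min.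
have := minimal_dominating_profile p'_prime q'_prime
  (introN eqP p'_neq_q') (prod_cyclic_pgroup p'_prime r'_exps)
  (prod_cyclic_pgroup q'_prime t'_exps) (prod_cyclic_abelian _ _)
  (prod_cyclic_abelian _ _) (prod_cyclic_gt1 p'_prime r'_exps)
  (prod_cyclic_gt1 q'_prime t'_exps) uv_min.
(* The transported edge may match the axes of the second product in either order, whence the two
   alternatives. *)
rewrite uvE xyE => -[] [cardP atomsQ maxP cardQ atomsP maxQ]; [left | right].
  have eP : axis_profile (prod_cyclic p r) (prod_cyclic q t) =
      axis_profile (prod_cyclic p' r') (prod_cyclic q' t').
    by rewrite /axis_profile cardP atomsQ maxP.
  have eQ : axis_profile (prod_cyclic q t) (prod_cyclic p r) =
      axis_profile (prod_cyclic q' t') (prod_cyclic p' r').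
    by rewrite /axis_profile cardQ atomsP maxQ.
  have [-> -> -> ->] := axis_profile_params p_prime q_prime p'_prime q'_prime
    r_exps t_exps r'_exps t'_exps eP eQ.
  by have [-> -> -> ->] := axis_profile_params q_prime p_prime q'_prime p'_prime
    t_exps r_exps t'_exps r'_exps eQ eP.
have eP : axis_profile (prod_cyclic p r) (prod_cyclic q t) =
    axis_profile (prod_cyclic q' t') (prod_cyclic p' r').
  by rewrite /axis_profile cardP atomsQ maxP.
have eQ : axis_profile (prod_cyclic q t) (prod_cyclic p r) =
    axis_profile (prod_cyclic p' r') (prod_cyclic q' t').
  by rewrite /axis_profile cardQ atomsP maxQ.
have [-> -> -> ->] := axis_profile_params p_prime q_prime q'_prime p'_prime
  r_exps t_exps t'_exps r'_exps eP eQ.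
by have [-> -> -> ->] := axis_profile_params q_prime p_prime p'_prime q'_prime
  t_exps r_exps r'_exps t'_exps eQ eP.
Qed.
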